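(* Let $m\ge1$, $\vec t=(t_1,\dots,t_m)$ with $t_1<\cdots<t_m$ real, and $\omega_0,\dots,\omega_m$ real with $\sum_{k=0}^\ell\omega_k\ge0$ for $\ell=0,\dots,m$, such that $w(x;\vec t)={\rm e}^{-x^2}\big(\omega_0+\sum_{k=1}^m\omega_k\theta(x-t_k)\big)$ is not identically zero. For $n\ge1$ let $D_n(\vec t)=\det\big(\int_{\mathbb{R}}x^{i+j}w(x;\vec t)dx\big)_{i,j=0}^{n-1}$ and $\sigma_n(\vec t)=\sum_{k=1}^m\frac{\partial}{\partial t_k}\ln D_n(\vec t)$. Then $\sigma_n$ satisfies the second order PDE $$\sum_{k=1}^m{\rm sgn}(\omega_k)\sqrt{\Delta_k(\vec t)}=2\Big(\sum_{k=1}^mt_k\frac{\partial\sigma_n}{\partial t_k}-\sigma_n\Big),$$ where ${\rm sgn}(\omega_k)$ is the sign of $\omega_k$ ($-1$, $0$ or $1$), $\sqrt{\cdot}$ is the nonnegative square root, $\mathcal L=\sum_{k=1}^m\partial/\partial t_k$, and $$\Delta_k(\vec t):=\Big(\frac{\partial^2\sigma_n}{\partial t_k^2}+\sum_{j\ne k}\frac{\partial^2\sigma_n}{\partial t_k\partial t_j}\Big)^2+4(\mathcal L\sigma_n+2n)\Big(\frac{\partial\sigma_n}{\partial t_k}\Big)^2.$$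
   Context: $\theta(y)=1$ for $y>0$ and $\theta(y)=0$ otherwise. *)

(* Defs.v *)
From HB Require Import structures.
From mathcomp Require Import all_boot all_order all_algebra.
From mathcomp Require Import all_classical all_reals all_analysis.
Set Implicit Arguments. Unset Strict Implicit. Unset Printing Implicit Defensive.
Import Order.TTheory GRing.Theory Num.Theory.
Import numFieldNormedType.Exports.
Local Open Scope ring_scope.

Definition theta {R : realType} (y : R) : R := if 0 < y then 1 else 0.

(* coordinate t_k of t = (t_1,...,t_m); k : 'I_m stands for index k+1 *)
Definition coord_t {R : realType} {m : nat} (t : 'rV[R]_m) (k : 'I_m) : R :=
  t ord0 k.

Definition weight {R : realType} {m : nat} (omega0 : R) (omega : 'I_m -> R)
  (t : 'rV[R]_m) (x : R) : R :=
  expR (- (x ^+ 2)) * (omega0 + \sum_(k < m) omega k * theta (x - coord_t t k)).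

Definition moment {R : realType} {m : nat} (omega0 : R) (omega : 'I_m -> R)
  (t : 'rV[R]_m) (p : nat) : R :=
  Rintegral (@lebesgue_measure R) setT (fun x => x ^+ p * weight omega0 omega t x).

Definition hankelD {R : realType} {m : nat} (omega0 : R) (omega : 'I_m -> R)
  (n : nat) (t : 'rV[R]_m) : R :=
  \det (\matrix_(i < n, j < n) moment omega0 omega t (i + j)%N).

Definition unitv {R : realType} {m : nat} (k : 'I_m) : 'rV[R]_m := delta_mx ord0 k.

Definition partial {R : realType} {m : nat} (k : 'I_m) (f : 'rV[R]_m -> R)
  (t : 'rV[R]_m) : R := 'D_(unitv k) f t.

Definition sigma_n {R : realType} {m : nat} (omega0 : R) (omega : 'I_m -> R)
  (n : nat) (t : 'rV[R]_m) : R :=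
  \sum_(k < m) partial k (fun s => ln (hankelD omega0 omega n s)) t.

Definition Lop {R : realType} {m : nat} (f : 'rV[R]_m -> R) (t : 'rV[R]_m) : R :=
  \sum_(k < m) partial k f t.

Definition Delta_k {R : realType} {m : nat} (sigma : 'rV[R]_m -> R) (n : nat)
  (k : 'I_m) (t : 'rV[R]_m) : R :=
  (partial k (partial k sigma) t
     + \sum_(j < m | j != k) partial j (partial k sigma) t) ^+ 2
  + 4 * (Lop sigma t + 2 * n%:R) * (partial k sigma t) ^+ 2.

(* Main.v *)
Require Import Defs.
From HB Require Import structures.
From mathcomp Require Import all_boot all_order all_algebra.
From mathcomp Require Import all_classical all_reals all_analysis.
From mathcomp Require Import measurable_realfun.
From mathcomp Require Import ring lra zify.
Set Implicit Arguments. Unset Strict Implicit. Unset Printing Implicit Defensive.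
Import Order.TTheory GRing.Theory Num.Theory.
Import numFieldNormedType.Exports.
Local Open Scope classical_set_scope.
Local Open Scope ring_scope.

(** Write w for the weight, L for the functional [Q |-> int Q w] on polynomials,
    P_n for its monic orthogonal polynomials with recurrence coefficients
    alpha_n, beta_n, and h_n = L(P_n^2), so that D_n = h_0 ... h_(n-1).

    The moments satisfy d mu_p / d t_k = - omega_k t_k^p exp(-t_k^2), and
    integrating (x^p exp(-x^2))' against the step function shows that the sum of
    these derivatives over k is p mu_(p-1) - 2 mu_(p+1).  Consequently
    sigma_n = -2 (alpha_0 + ... + alpha_(n-1)) is twice the subleading coefficient
    of P_n; its t_k-derivative is 2 w_k (P_n P_(n-1))(t_k) / h_(n-1) with
    w_k = omega_k exp(-t_k^2); and (sum_j d/dt_j + d/dx) P_n = 2 beta_n P_(n-1).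
    Differentiating once more and eliminating P_(n-2) by the recurrence, one gets
    sum_k d sigma_n / d t_k + 2 n = 4 beta_n and
      Delta_k = (4 w_k (beta_n P_(n-1)(t_k)^2 + P_n(t_k)^2) / h_(n-1))^2,
    a perfect square in which only omega_k has a sign.  Both sides of the PDE are
    then evaluated to 8 beta_n (alpha_n + alpha_(n-1)) by applying the moment
    identity to P_(n-1)^2, P_n^2 and x P_n P_(n-1). *)

(** * Gaussian monomials and their integrals *)

Section GaussianMonomials.
Context {R : realType}.
Notation mu := (@lebesgue_measure R).

Definition gmon (p : nat) (x : R) : R := x ^+ p * expR (- (x ^+ 2)).

(** One half of the exponent absorbs the power of [x], by $e^y\ge 1+y^{p+1}/(p+1)!$ at $y=x^2/2$.
    The half that is left is a multiple of the standard normal density, whose integrability then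
    dominates [gmon p]. *)
Lemma gmon_le p : exists C : R, forall x, `|gmon p x| <= C * expR (- (x ^+ 2 / 2)).
Proof.
exists (1 + 2 ^+ p.+1 * (p.+1)`!%:R) => x.
have e2 : expR (- x ^+ 2) = expR (- (x ^+ 2 / 2)) * expR (- (x ^+ 2 / 2)).
  by rewrite -expRD; congr expR; lra.
rewrite /gmon normrM (ger0_norm (expR_ge0 _)) e2 mulrA ler_wpM2r ?expR_ge0//.
rewrite expRN ler_pdivrMr ?expR_gt0// normrX.
have y0 : 0 <= x ^+ 2 / 2 by rewrite divr_ge0 ?sqr_ge0.
have := expR_ge1Dxn p y0; rewrite -lerBrDl ler_pdivrMr ?ltr0n ?fact_gt0//.
set E := expR _; set F := (p.+1)`!%:R => h.
have F0 : 0 <= F by rewrite ler0n.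
have E1 : 1 <= E by rewrite -expR0 ler_expR.
have xp : `|x| ^+ p <= 1 + (x ^+ 2) ^+ p.+1.
  have [x1|/ltW x1] := leP `|x| 1.
    by apply: (@le_trans _ _ 1); rewrite ?exprn_ile1// lerDl exprn_ge0// sqr_ge0.
  apply: (@le_trans _ _ ((x ^+ 2) ^+ p.+1)); last by rewrite lerDr.
  rewrite -[x ^+ 2]real_normK ?num_real// -exprM.
  by rewrite ler_weXn2l// mulnS mul2n -addnn; lia.
have {}xp : `|x| ^+ p <= 1 + 2 ^+ p.+1 * (x ^+ 2 / 2) ^+ p.+1.
  by rewrite -exprMn mulrC divfK.
apply: (le_trans xp); rewrite mulrDl mul1r lerD//.
rewrite -[leRHS]mulrA ler_wpM2l ?exprn_ge0//.
by apply: (le_trans h); rewrite mulrC ler_wpM2l// lerBlDr lerDl.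
Qed.

Lemma gmon_bounded p : exists C : R, forall x, `|gmon p x| <= C.
Proof.
have [C hC] := gmon_le p; exists C => x; apply: (le_trans (hC x)).
rewrite ler_piMr//; last by rewrite expR_le1 oppr_le0 divr_ge0 ?sqr_ge0.
by have := le_trans (normr_ge0 _) (hC 0); rewrite expr0n/= mul0r oppr0 expR0 mulr1.
Qed.

Lemma continuous_gmon p : continuous (gmon p).
Proof.
move=> x; apply: cvgM; first exact: exprn_continuous.
apply: (cvg_comp (fun x => - x ^+ 2) expR); last exact: continuous_expR.
by apply: cvgN; exact: exprn_continuous.
Qed.

Lemma integrable_gmon p : mu.-integrable setT (EFin \o gmon p).
Proof.
have [C hC] := gmon_le p.
have pk : normal_peak (1 : R) != 0 by rewrite gt_eqF// normal_peak_gt0// oner_eq0.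
apply: (@le_integrable _ _ _ mu setT measurableT (EFin \o gmon p)
  (fun x : R => (C / normal_peak 1)%:E * (normal_pdf 0 1 x)%:E)%E).
- apply/measurable_EFinP; apply: continuous_measurable_fun.
  exact: continuous_gmon.
- move=> x _ /=; rewrite lee_fin (le_trans (hC x))// (le_trans _ (ler_norm _))//.
  rewrite normal_pdfE ?oner_eq0// mulrA divfK// /normal_fun subr0 expr1n.
  by rewrite mulNr.
- by apply: integrableZl => //; exact: integrable_normal_pdf.
Qed.

Lemma gmonS p x : gmon p.+1 x = x * gmon p x.
Proof. by rewrite /gmon exprS mulrA. Qed.

Lemma is_derive_gmon (p : nat) (x : R) :
  is_derive x (1 : R) (gmon p) (p%:R * gmon p.-1 x - 2 * gmon p.+1 x).
Proof.
have dX n : is_derive x (1 : R) (fun y : R => y ^+ n) (n%:R * x ^+ n.-1).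
  rewrite (_ : (fun y : R => y ^+ n) = id ^+ n); last first.
    by apply/funext => y; rewrite exprfctE.
  apply: (is_derive_eq (@is_deriveX _ _ id n x 1 1 (is_derive_id _ _))).
  by rewrite scaler1.
have dE : is_derive x (1 : R) (fun y : R => expR (- y ^+ 2))
    (expR (- x ^+ 2) * - (2 * x)).
  apply: (@is_derive1_comp _ expR (fun y : R => - y ^+ 2)).
apply: is_derive_eq (is_deriveM (dX p) dE) _.
by rewrite /gmon /GRing.scale/= (exprS x p); ring.
Qed.

Lemma cvg_gmon0 p (u : R^nat) : (forall n, n%:R <= `|u n|) ->
  gmon p (u n) @[n --> \oo] --> 0.
Proof.
move=> hu; have [C hC] := gmon_bounded p.+1.
apply/cvgr0Pnorm_le => e e0; near=> n.
have n0 : 0 < n%:R :> R by near: n; exact: nbhs_infty_gtr.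
have un : 0 < `|u n| by rewrite (lt_le_trans n0).
(* One more factor [u n] still gives a bounded function, [gmon p.+1], so [gmon p (u n)] is at most
   [C / n]. *)
rewrite -(ler_pM2l un) -normrM -gmonS (le_trans (hC _))//.
apply: (@le_trans _ _ (n%:R * e)); last by rewrite ler_wpM2r// ltW.
by rewrite -ler_pdivrMr//; near: n; exact: nbhs_infty_ger.
Unshelve. all: by end_near. Qed.

End GaussianMonomials.

(** * Integration by parts and differentiation for Gaussian tail integrals *)

Section GaussianIntegrals.
Context {R : realType}.
Notation mu := (@lebesgue_measure R).

(** Dominated convergence with dominating function $|f|$. It carries the fundamental theorem of
    calculus from segments to half-lines and to the whole line. *)
Lemma cvg_Rintegral_eventually (f : R -> R) (A : (set R)^nat) (B : set R) :
  mu.-integrable setT (EFin \o f) ->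
  (forall n, measurable (A n)) -> measurable B ->
  (forall x, \forall n \near \oo, (x \in A n) = (x \in B)) ->
  Rintegral mu (A n) f @[n --> \oo] --> Rintegral mu B f.
Proof.
move=> fi mA mB AB.
have fiD (D : set R) : measurable D -> mu.-integrable setT (EFin \o (f \_ D)).
  move=> mD; rewrite -restrict_EFin.
  have fD : mu.-integrable D (EFin \o f) by apply: integrableS fi.
  by move/integrable_mkcond : fD; apply.
have [] := @dominated_convergence _ _ _ mu setT measurableT
  (fun n => EFin \o (f \_ (A n))) (EFin \o (f \_ B)) (fun x => `|(f x)%:E|%E).
- by move=> n; apply: measurable_int (fiD _ (mA n)).
- by apply: measurable_int (fiD _ mB).
- apply: aeW => x _; apply: cvg_near_cst.
  by near=> n; rewrite /= !patchE; near: n; apply: filterS (AB x) => n ->.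
- exact: integrable_abse.
- apply: aeW => x n _; rewrite /= patchE; case: ifP => // _.
  by rewrite lee_fin normr0.
move=> fiB _ h.
rewrite [X in _ --> X]Rintegral_mkcond.
rewrite (_ : (fun n => _) = fun n => Rintegral mu setT (f \_ (A n))); last first.
  by apply/funext => n; rewrite Rintegral_mkcond.
apply: fine_cvg; rewrite fineK; last by apply: integrable_fin_num.
exact: h.
Unshelve. all: by end_near. Qed.

Let dgmon (p : nat) (x : R) := p%:R * gmon p.-1 x - 2 * gmon p.+1 x.

Let continuous_dgmon p : continuous (dgmon p).
Proof.
move=> x; apply: cvgB; (apply: cvgM; first exact: cvg_cst); exact: continuous_gmon.
Qed.

Let integrable_dgmon p : mu.-integrable setT (EFin \o dgmon p).
Proof.
rewrite (_ : EFin \o _ = (fun x =>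
    p%:R%:E * (gmon p.-1 x)%:E + (- 2)%:E * (gmon p.+1 x)%:E)%E).
  by apply: integrableD => //; apply: integrableZl => //; exact: integrable_gmon.
by apply/funext => x; rewrite /= -!EFinM -EFinD mulNr.
Qed.

Let RintegralS_dgmon p a b : a < b ->
  Rintegral mu `[a, b] (dgmon p) = gmon p b - gmon p a.
Proof.
move=> ab; rewrite /Rintegral (@continuous_FTC2 _ _ (gmon p))//.
- by apply: continuous_subspaceT; exact: continuous_dgmon.
- split.
  + by move=> x _; have [] := is_derive_gmon p x.
  + by apply: cvg_at_right_filter; exact: continuous_gmon.
  + by apply: cvg_at_left_filter; exact: continuous_gmon.
- by move=> x _; rewrite derive1E; have [] := is_derive_gmon p x.
Qed.

Let Rintegral_dgmon_lin p D : measurable D -> Rintegral mu D (dgmon p) =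
  p%:R * Rintegral mu D (gmon p.-1) - 2 * Rintegral mu D (gmon p.+1).
Proof.
move=> mD; have gi q : mu.-integrable D (EFin \o @gmon R q).
  by apply: integrableS (integrable_gmon q).
have gZ c q : mu.-integrable D (EFin \o (fun x => c * @gmon R q x)).
  by apply: (integrableZl mD c (gi q)).
by rewrite /dgmon RintegralB// !RintegralZl.
Qed.

(** The integrand is the derivative of [gmon p], and the boundary term at infinity vanishes. *)
Lemma Rintegral_gmon_tail_rec (p : nat) (a : R) :
  p%:R * Rintegral mu `]a, +oo[ (gmon p.-1) - 2 * Rintegral mu `]a, +oo[ (gmon p.+1)
  = - gmon p a.
Proof.
rewrite -Rintegral_dgmon_lin// Rintegral_itv_obnd_cbnd; last first.
  by apply: integrableS (integrable_dgmon p).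
(* The term $2|a|$ outweighs a negative [a], so that [b n] exceeds both [a] and [n]. *)
pose b n := a + (n%:R + 2 * `|a| + 1).
have ab n : a < b n by rewrite ltrDl ltr_wpDl// addr_ge0// mulr_ge0.
have bn n : n%:R <= b n.
  rewrite /b; have := lerNnormlW (lexx `|a|).
  by have := normr_ge0 a; lra.
have h1 : Rintegral mu `[a, b n] (dgmon p) @[n --> \oo] -->
    Rintegral mu `[a, +oo[ (dgmon p).
  apply: (@cvg_Rintegral_eventually _ (fun n => `[a, b n]%classic) `[a, +oo[%classic
    (integrable_dgmon p)) => // x.
  near=> n; apply/idP/idP; rewrite !inE/= !in_itv/= ?andbT; first by case/andP.
  move=> ->/=; apply: le_trans (bn n).
  by near: n; exact: nbhs_infty_ger.
have h2 : Rintegral mu `[a, b n] (dgmon p) @[n --> \oo] --> 0 - gmon p a.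
  under eq_fun do rewrite RintegralS_dgmon//.
  apply: cvgB; last exact: cvg_cst.
  by apply: cvg_gmon0 => n; apply: le_trans (bn n) (ler_norm _).
by rewrite (cvg_unique _ h1 h2)// sub0r.
Unshelve. all: by end_near. Qed.

Lemma Rintegral_gmon_rec (p : nat) :
  p%:R * Rintegral mu setT (gmon p.-1) - 2 * Rintegral mu setT (gmon p.+1) = 0.
Proof.
rewrite -Rintegral_dgmon_lin//.
have h1 : Rintegral mu `[- n.+1%:R, n.+1%:R] (dgmon p) @[n --> \oo] -->
    Rintegral mu setT (dgmon p).
  apply: (@cvg_Rintegral_eventually _ (fun n => `[- n.+1%:R, n.+1%:R]%classic) setT
    (integrable_dgmon p)) => // x.
  near=> n; rewrite [RHS]in_setT; apply/idP; rewrite inE/= in_itv/= -ler_norml ltW//.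
  rewrite (@le_lt_trans _ _ n%:R) ?ltr_nat//.
  by near: n; exact: nbhs_infty_ger.
have h2 : Rintegral mu `[- n.+1%:R, n.+1%:R] (dgmon p) @[n --> \oo] --> (0 - 0 : R).
  have h n : - n.+1%:R < n.+1%:R :> R by rewrite gtrN.
  under eq_fun do rewrite RintegralS_dgmon//.
  by apply: cvgB; apply: cvg_gmon0 => n; rewrite ?normrN normr_nat ler_nat.
by rewrite (cvg_unique _ h1 h2) ?subrr.
Unshelve. all: by end_near. Qed.

Lemma is_derive_gmon_tail (p : nat) (a : R) :
  is_derive a (1 : R) (fun x => Rintegral mu `]x, +oo[ (gmon p)) (- gmon p a).
Proof.
have gi := @integrable_gmon R p.
(* The tail is the total minus the integral up to [x], which puts the variable at an upper
   endpoint. *)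
rewrite (_ : (fun x => _) = cst (Rintegral mu setT (gmon p)) -
    (fun x => Rintegral mu `]-oo, x] (gmon p))); last first.
  by apply/funext => x; rewrite -(@Rintegral_itvB _ _ -oo%O)// ?set_itvNyy.
have [d1 d2] := @continuous_FTC1 R (gmon p) -oo%O a (a + 1) ltac:(by rewrite ltrDl)
  ltac:(by apply: integrableS gi) (ltNyr _) (@continuous_gmon R p a).
rewrite -[- gmon p a]add0r; apply: is_deriveB.
by apply: DeriveDef; [exact: d1|rewrite -derive1E].
Qed.

End GaussianIntegrals.

(** * Moment functionals and orthogonal polynomials *)

Section MomentFunctional.
Context {R : comNzRingType}.
Implicit Types (mu : nat -> R) (P Q : {poly R}).

(** The functional L, taken from a bare sequence so that it also applies to the derivatives of the
    moments and to [pearson mu]. *)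
Definition mfun mu Q : R := \sum_(i < size Q) Q`_i * mu i.

Lemma mfunE mu Q n : (size Q <= n)%N -> mfun mu Q = \sum_(i < n) Q`_i * mu i.
Proof.
move=> Qn; rewrite /mfun (big_ord_widen n (fun i => Q`_i * mu i))//.
rewrite [RHS](bigID (fun i : 'I_n => (i < size Q)%N))/=.
rewrite [X in _ + X]big1 ?addr0// => i; rewrite -leqNgt => /leq_sizeP ->//.
by rewrite mul0r.
Qed.

Lemma mfunD mu P Q : mfun mu (P + Q) = mfun mu P + mfun mu Q.
Proof.
rewrite (mfunE _ (size_polyD P Q)) (mfunE mu (leq_maxl (size P) (size Q))).
rewrite (mfunE mu (leq_maxr (size P) (size Q))) -big_split/=.
by apply: eq_bigr => i _; rewrite coefD mulrDl.
Qed.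

Lemma mfunZ mu c Q : mfun mu (c *: Q) = c * mfun mu Q.
Proof.
rewrite (mfunE _ (size_scale_leq c Q)) mulr_sumr.
by apply: eq_bigr => i _; rewrite coefZ mulrA.
Qed.

Lemma mfunN mu Q : mfun mu (- Q) = - mfun mu Q.
Proof. by rewrite -scaleN1r mfunZ mulN1r. Qed.

Lemma mfunB mu P Q : mfun mu (P - Q) = mfun mu P - mfun mu Q.
Proof. by rewrite mfunD mfunN. Qed.

Lemma mfun0 mu : mfun mu 0 = 0.
Proof. by rewrite /mfun size_poly0 big_ord0. Qed.

Lemma mfun_sum mu (I : Type) (r : seq I) (P : pred I) (F : I -> {poly R}) :
  mfun mu (\sum_(i <- r | P i) F i) = \sum_(i <- r | P i) mfun mu (F i).
Proof. exact: (big_morph _ (mfunD mu) (mfun0 mu)). Qed.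

Lemma mfunXn mu n : mfun mu 'X^n = mu n.
Proof.
rewrite (@mfunE mu _ n.+1) ?size_polyXn// big_ord_recr/= big1 ?add0r.
  by rewrite coefXn eqxx mul1r.
by move=> i _; rewrite coefXn ltn_eqF// mul0r.
Qed.

Lemma mfun_summ (I : Type) (r : seq I) (f : I -> nat -> R) Q :
  mfun (fun p => \sum_(i <- r) f i p) Q = \sum_(i <- r) mfun (f i) Q.
Proof. by rewrite /mfun exchange_big/=; apply: eq_bigr => j _; rewrite mulr_sumr. Qed.

Lemma eq_mfun mu1 mu2 Q : mu1 =1 mu2 -> mfun mu1 Q = mfun mu2 Q.
Proof. by move=> e; apply: eq_bigr => i _; rewrite e. Qed.

(** Such a sequence lists the moments of a point mass; the $t_k$-derivatives of the moments have
    this form. *)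
Lemma mfun_horner a x Q : mfun (fun p => a * x ^+ p) Q = a * Q.[x].
Proof.
by rewrite horner_coef mulr_sumr; apply: eq_bigr => i _; rewrite mulrCA.
Qed.

(* If [mu] lists the moments of exp(-x^2) times a function g, this is the integral
   of (x^p exp(-x^2))' g. At [p = 0] the junk value [mu 0.-1] has coefficient 0. *)
Definition pearson mu (p : nat) : R := p%:R * mu p.-1 - 2 * mu p.+1.

(** This is $(Qe^{-x^2})'=(Q'-2xQ)e^{-x^2}$, extended linearly from monomials. *)
Lemma mfun_pearson mu Q :
  mfun (pearson mu) Q = mfun mu Q^`() - 2 * mfun mu ('X * Q).
Proof.
rewrite -[in LHS](coefK Q) -[in RHS](coefK Q) poly_def.
rewrite raddf_sum (mulr_sumr _ _ _ 'X) !mfun_sum.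
rewrite [X in _ = _ - X]mulr_sumr -sumrB; apply: eq_bigr => i _.
rewrite /= derivZ derivXn -scaler_nat -scalerAr -exprS !mfunZ !mfunXn.
by rewrite /pearson mulrBr; congr (_ - _); rewrite mulrCA.
Qed.

End MomentFunctional.

(** * Orthogonal polynomials from the three-term recurrence *)

Section OrthogonalPolynomials.
Context {R : realFieldType}.
Implicit Types (mu : nat -> R) (P Q : {poly R}).

Definition posdef mu := forall Q, Q != 0 -> 0 < mfun mu (Q * Q).

(** The recurrence itself serves as the definition: it makes [op] monic for every sequence [mu], and
    differentiability in parameters follows by induction. Orthogonality is proved later, for
    positive definite [mu]. *)
Fixpoint op mu (n : nat) : {poly R} :=
  if n is k.+1 then
    ('X - (mfun mu ('X * (op mu k * op mu k)) / mfun mu (op mu k * op mu k))%:P)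
      * op mu k
    - (if k is l.+1 then
         (mfun mu (op mu k * op mu k) / mfun mu (op mu l * op mu l)) *: op mu l
       else 0)
  else 1.

(* The conventions P_(-1) = 0 and beta_0 = 0 let the recurrence hold at [n = 0]. *)
Definition op_pred mu (n : nat) : {poly R} := if n is k.+1 then op mu k else 0.
Definition nrm mu n := mfun mu (op mu n * op mu n).
Definition alpha mu n := mfun mu ('X * (op mu n * op mu n)) / nrm mu n.
Definition beta mu n := if n is k.+1 then nrm mu n / nrm mu k else 0.
Definition subl mu n := if n is k.+1 then (op mu n)`_k else 0.

#[global] Arguments op : simpl never.

Lemma opS mu n :
  op mu n.+1 = ('X - (alpha mu n)%:P) * op mu n - beta mu n *: op_pred mu n.
Proof. by case: n => [|n] //; rewrite /op_pred scaler0. Qed.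

Lemma coef_opS mu n i : (op mu n.+1)`_i =
  ('X * op mu n)`_i - alpha mu n * (op mu n)`_i - beta mu n * (op_pred mu n)`_i.
Proof. by rewrite opS mulrBl !coefB coefCM coefZ. Qed.

Lemma op_size_monic mu n : (size (op mu n) <= n.+1)%N /\ (op mu n)`_n = 1.
Proof.
(* The recurrence reaches back two steps, so the induction carries two consecutive indices. *)
suff [] : ((size (op mu n) <= n.+1)%N /\ (op mu n)`_n = 1) /\
  ((size (op mu n.+1) <= n.+2)%N /\ (op mu n.+1)`_(n.+1) = 1) by [].
elim: n => [|n [ih1 ih2]].
  have e1 : (size (op mu 0) <= 1)%N /\ (op mu 0)`_0 = 1 by rewrite size_poly1 coef1.
  split=> //; split.
    apply/leq_sizeP => -[|[|j]]// _.
    by rewrite coef_opS coefXM !coef1 /= coef0 !mulr0 !subr0.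
  by rewrite coef_opS coefXM !coef1 /= coef0 !mulr0 !subr0.
split=> //; case: ih2 => /leq_sizeP s2 c2; case: ih1 => /leq_sizeP s1 c1.
split.
  apply/leq_sizeP => -[|j]// jn.
  by rewrite coef_opS coefXM/= !(s2 _, s1 _) ?mulr0 ?subr0//; lia.
by rewrite coef_opS coefXM/= c2 s2 ?s1 ?mulr0 ?subr0//; lia.
Qed.

Lemma op_lead mu n : (op mu n)`_n = 1. Proof. by have [] := op_size_monic mu n. Qed.

Lemma size_op_le mu n : (size (op mu n) <= n.+1)%N.
Proof. by have [] := op_size_monic mu n. Qed.

Lemma op_neq0 mu n : op mu n != 0.
Proof.
apply/eqP => h; have /eqP := op_lead mu n.
by rewrite h coef0 eq_sym oner_eq0.
Qed.

Lemma size_op_pred mu n : (size (op_pred mu n) <= n)%N.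
Proof. by case: n => [|n]; rewrite ?size_poly0 ?size_op_le. Qed.

Lemma sublS mu n : subl mu n.+1 = subl mu n - alpha mu n.
Proof.
rewrite /subl coef_opS op_lead mulr1 [(op_pred mu n)`_n]nth_default ?size_op_pred//.
by rewrite mulr0 subr0 coefXM; case: n.
Qed.

Lemma subl_sum mu n : subl mu n = - \sum_(j < n) alpha mu j.
Proof.
elim: n => [|n ih]; first by rewrite big_ord0 oppr0.
by rewrite sublS ih big_ord_recr opprD.
Qed.

Lemma size_XM_le n Q : (size Q <= n)%N -> (size ('X * Q)%R <= n.+1)%N.
Proof.
by move=> Qn; rewrite (leq_trans (size_polyMleq _ _))// size_polyX.
Qed.

Section PositiveDefinite.
Variable mu : nat -> R.
Hypothesis mu_pos : posdef mu.

Lemma nrm_gt0 n : 0 < nrm mu n. Proof. exact/mu_pos/op_neq0. Qed.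

Lemma nrm_neq0 n : nrm mu n != 0. Proof. by rewrite gt_eqF ?nrm_gt0. Qed.

Lemma mfun_alpha n : mfun mu ('X * (op mu n * op mu n)) = alpha mu n * nrm mu n.
Proof. by rewrite divfK ?nrm_neq0. Qed.

Let size_reduce n Q : (size Q <= n.+1)%N -> (size (Q - Q`_n *: op mu n)%R <= n)%N.
Proof.
move=> Qn; apply/leq_sizeP => j; rewrite leq_eqVlt coefB coefZ => /predU1P[<-|nj].
  by rewrite op_lead mulr1 subrr.
rewrite (leq_sizeP _ _ Qn _ nj) (leq_sizeP _ _ (size_op_le mu n) _ nj).
by rewrite mulr0 subrr.
Qed.

(** Subtracting the leading term times [op mu n] leaves a lower degree. Orthogonality is a premise
    because this is used inside the induction that establishes it. *)
Let op_proj n Q : (forall Q, (size Q <= n)%N -> mfun mu (op mu n * Q) = 0) ->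
  (size Q <= n.+1)%N -> mfun mu (op mu n * Q) = Q`_n * nrm mu n.
Proof.
move=> on Qn; rewrite -[Q in LHS](subrK (Q`_n *: op mu n)) mulrDr mfunD.
by rewrite -scalerAr mfunZ on ?add0r// size_reduce.
Qed.

Lemma op_orthogonal n Q : (size Q <= n)%N -> mfun mu (op mu n * Q) = 0.
Proof.
suff : (forall Q, (size Q <= n)%N -> mfun mu (op mu n * Q) = 0) /\
       (forall Q, (size Q <= n.-1)%N -> mfun mu (op_pred mu n * Q) = 0).
  by case=> + _; exact.
elim: n {Q} => [|n [on opn]].
  by split=> Q; rewrite leqn0 size_poly_eq0 => /eqP ->; rewrite mulr0 mfun0.
split=> // Q Qn.
have Sn P : mfun mu (op mu n.+1 * P) = mfun mu (op mu n * ('X * P))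
    - alpha mu n * mfun mu (op mu n * P) - beta mu n * mfun mu (op_pred mu n * P).
  rewrite opS mulrBl mulrBl mulrBl !mfunB mul_polyC.
  rewrite -[(_ *: op mu n) * P]scalerAl -[(_ *: op_pred mu n) * P]scalerAl !mfunZ.
  by rewrite [op _ _ * ('X * _)]mulrCA mulrA.
(* Split [Q] into its component along [op mu n] and a remainder of lower degree: the choice of
   [alpha] cancels the first contribution, that of [beta] the leading coefficient of the second. *)
rewrite Sn -[Q](subrK (Q`_n *: op mu n)).
set Q' := Q - _; have Q'n : (size Q' <= n)%N by exact: size_reduce.
have -> : mfun mu (op_pred mu n * (Q' + Q`_n *: op mu n)) = mfun mu (op_pred mu n * Q').
  rewrite mulrDr mfunD -scalerAr mfunZ [op_pred _ _ * op _ _]mulrC.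
  by rewrite on ?size_op_pred// mulr0 addr0.
have -> : mfun mu (op mu n * (Q' + Q`_n *: op mu n)) = Q`_n * nrm mu n.
  by rewrite mulrDr mfunD -scalerAr mfunZ on// add0r.
have -> : mfun mu (op mu n * ('X * (Q' + Q`_n *: op mu n))) =
    ('X * Q')`_n * nrm mu n + Q`_n * (alpha mu n * nrm mu n).
  rewrite mulrDr mulrDr mfunD -[in LHS]scalerAr -[in LHS]scalerAr mfunZ.
  rewrite [op mu n * ('X * op mu n)]mulrCA mfun_alpha op_proj//.
  exact: size_XM_le.
clearbody Q'; case: n on opn Sn Qn Q'n => [|n] on opn Sn Qn Q'n.
  by rewrite coefXM eqxx /= !mul0r; ring.
have -> : mfun mu (op_pred mu n.+1 * Q') = Q'`_n * nrm mu n by apply: op_proj.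
rewrite coefXM /=.
rewrite /beta.
by have := nrm_neq0 n; move=> ?; field.
Qed.

Lemma mfun_op_proj n Q : (size Q <= n.+1)%N ->
  mfun mu (op mu n * Q) = Q`_n * nrm mu n.
Proof. by apply: op_proj => S; exact: op_orthogonal. Qed.

End PositiveDefinite.
End OrthogonalPolynomials.

(** * Moment identities for products of orthogonal polynomials, and the Hankel determinant *)

Section PearsonIdentities.
Context {R : realFieldType} (mu : nat -> R) (mu_pos : posdef mu).
Implicit Types (Q : {poly R}).

Lemma mfun_nondegenerate n Q : (size Q <= n)%N ->
  (forall S : {poly R}, (size S <= n)%N -> mfun mu (Q * S) = 0) -> Q = 0.
Proof.
move=> Qn h; apply/eqP; apply: contraT => /mu_pos.
by rewrite h// ltxx.
Qed.

Lemma size_deriv_le n Q : (size Q <= n.+1)%N -> (size Q^`() <= n)%N.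
Proof.
by move=> Qn; rewrite (leq_trans (size_poly _ _))// -subn1 leq_subLR add1n.
Qed.

(** The derivative $2P_nP_n'$ is killed by orthogonality; only $-2L(xP_n^2)$ survives. *)
Lemma pearson_op_sqr n :
  mfun (pearson mu) (op mu n * op mu n) = - (2 * (alpha mu n * nrm mu n)).
Proof.
have dn : (size (op mu n)^`() <= n)%N by apply/size_deriv_le/size_op_le.
rewrite mfun_pearson derivM mfunD [_^`() * _]mulrC op_orthogonal// mfun_alpha//.
by rewrite !add0r.
Qed.

Lemma coef_deriv_op n : (op mu n.+1)^`()`_n = n.+1%:R.
Proof. by rewrite coef_deriv op_lead. Qed.

(** Only leading coefficients survive: $n+1$ from $P_{n+1}'$ against $P_n$, and 1 from $xP_n$
    against $P_{n+1}$. *)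
Lemma pearson_op_succ n : mfun (pearson mu) (op mu n.+1 * op mu n) =
  n.+1%:R * nrm mu n - 2 * nrm mu n.+1.
Proof.
have dn k : (size (op mu k.+1)^`() <= k.+1)%N by apply/size_deriv_le/size_op_le.
have dn0 : (size (op mu n)^`() <= n.+1)%N.
  by apply: leq_trans (size_deriv_le (size_op_le mu n)) _.
rewrite mfun_pearson derivM mfunD [_^`() * _]mulrC mfun_op_proj// coef_deriv_op.
rewrite op_orthogonal// addr0 mulrCA mfun_op_proj ?size_XM_le ?size_op_le//.
by rewrite coefXM/= op_lead mul1r.
Qed.

Lemma pearson_X_op_succ n : mfun (pearson mu) ('X * (op mu n.+1 * op mu n)) =
  - (subl mu n.+1 * nrm mu n) - 2 * ((alpha mu n.+1 + alpha mu n) * nrm mu n.+1).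
Proof.
set b := op mu n.+1; set a := op mu n.
have sa : (size a <= n.+1)%N := size_op_le mu n.
have sb : (size b <= n.+2)%N := size_op_le mu n.+1.
have sXa' : (size ('X * a^`())%R <= n.+1)%N by apply/size_XM_le/size_deriv_le.
(* The Euler operator multiplies $x^{n+1}$ by $n+1$, so this combination has degree at most $n$; its
   $x^n$ coefficient is $(n-(n+1))$ times the subleading coefficient of [b]. *)
have sXb' : (size ('X * b^`() - n.+1%:R *: b)%R <= n.+1)%N.
  apply/leq_sizeP => j; rewrite leq_eqVlt coefB coefXM coefZ => /predU1P[<-|nj].
    by rewrite /= coef_deriv_op op_lead mulr1 subrr.
  rewrite (leq_sizeP _ _ sb _ nj) mulr0 subr0; case: j nj => // j nj.
  by rewrite (leq_sizeP _ _ (size_deriv_le sb)).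
have cXb' : ('X * b^`() - n.+1%:R *: b)`_n = - subl mu n.+1.
  rewrite coefB coefXM coefZ /subl /b; case: (n) => [|k] /=.
    by rewrite sub0r mul1r.
  by rewrite coef_deriv -mulr_natl -[k.+2%:R]natr1; ring.
rewrite mfun_pearson; congr (_ - _ * _).
  rewrite derivM derivX mul1r derivM mulrDr !mfunD.
  rewrite op_orthogonal// add0r.
  rewrite [X in _ + mfun _ X]mulrCA [X in _ + X]op_orthogonal// addr0.
  have -> : 'X * (b^`() * a) = a * ('X * b^`() - n.+1%:R *: b) + n.+1%:R *: (b * a).
    rewrite mulrBr -[_ * (_ *: _)]scalerAr [b * a]mulrC subrK; ring.
  rewrite mfunD mfunZ (op_orthogonal mu_pos sa) mulr0 addr0.
  by rewrite mfun_op_proj// cXb' mulNr.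
have Xa : 'X * a = b + alpha mu n *: a + beta mu n *: op_pred mu n.
  by rewrite /b opS mulrBl mul_polyC addrAC subrK subrK.
have -> : 'X * ('X * (b * a)) = b * ('X * ('X * a)) by ring.
have lin (c d : R) (u x y z : {poly R}) :
    mfun mu (u * ('X * (x + c *: y + d *: z))) = mfun mu (u * ('X * x)) +
      c * mfun mu (u * ('X * y)) + d * mfun mu (u * ('X * z)).
  by rewrite !mulrDr -![_ * (_ *: _)]scalerAr !mfunD !mfunZ.
rewrite Xa lin [b * ('X * b)]mulrCA mfun_alpha//.
rewrite (mfun_op_proj mu_pos (size_XM_le sa)) coefXM/= op_lead.
rewrite op_orthogonal ?size_XM_le ?size_op_pred//; ring.
Qed.

(** [D] stands for the sum over j of the $t_j$-derivatives of $P_n$. Both sides have degree below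
    $n$ and agree against every such [Q]: after cancellation the left one gives $2L(xQP_n)$, which
    is $2h_n$ times the top coefficient of [Q]. *)
Lemma pearson_toda n (D : {poly R}) : (size D <= n)%N ->
  (forall Q, (size Q <= n)%N -> mfun mu (D * Q) = - mfun (pearson mu) (op mu n * Q)) ->
  D + (op mu n)^`() = (2 * beta mu n) *: op_pred mu n.
Proof.
move=> Dn hD; apply/eqP; rewrite -subr_eq0; apply/eqP.
apply: (@mfun_nondegenerate n).
  rewrite (leq_trans (size_polyD _ _))// geq_max size_polyN.
  rewrite (leq_trans (size_scale_leq _ _)) ?size_op_pred// andbT.
  by rewrite (leq_trans (size_polyD _ _))// geq_max Dn size_deriv_le ?size_op_le.
move=> Q Qn; rewrite mulrBl mulrDl mfunB mfunD hD// mfun_pearson derivM mfunD.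
rewrite (@op_orthogonal _ _ _ n Q^`())//; last by apply: size_deriv_le; apply: leqW.
rewrite mulrCA mfun_op_proj ?size_XM_le// -scalerAl mfunZ.
case: n Dn hD Qn => [|n] Dn hD Qn; first by rewrite coefXM /=; ring.
rewrite coefXM /= mfun_op_proj// /beta.
by have := nrm_neq0 mu_pos n; move=> ?; field.
Qed.

(** The Hankel matrix is the Gram matrix of the monomials; the sums are nested as in a product of
    three matrices. *)
Lemma mfunM n (P Q : {poly R}) : (size P <= n)%N -> (size Q <= n)%N ->
  mfun mu (P * Q) = \sum_(k < n) (\sum_(l < n) P`_l * mu (l + k)%N) * Q`_k.
Proof.
have e (S : {poly R}) : (size S <= n)%N -> S = \sum_(k < n) S`_k *: 'X^k.
  move=> Sn; rewrite -poly_def; apply/polyP => i; rewrite coef_poly.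
  by case: ltnP => // /(leq_sizeP _ _ Sn) ->.
move=> /e {1}-> /e {1}->; rewrite mulr_sumr mfun_sum; apply: eq_bigr => k _.
rewrite !mulr_suml mfun_sum; apply: eq_bigr => l _.
rewrite -[_ * (_ *: _)]scalerAr -[(_ *: _) * _]scalerAl !mfunZ -exprD mfunXn.
by rewrite mulrC.
Qed.

(** The coefficient matrix [T] of the orthogonal polynomials is lower triangular with unit diagonal,
    and congruence by it turns the Hankel matrix into the diagonal matrix of the norms. *)
Lemma det_hankel n :
  \det (\matrix_(i < n, j < n) mu (i + j)%N) = \prod_(i < n) nrm mu i.
Proof.
set H := \matrix_(i, j) _.
pose T : 'M[R]_n := \matrix_(i, j) (op mu i)`_j.
have so (i : 'I_n) : (size (op mu i) <= n)%N by rewrite (leq_trans (size_op_le _ _)).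
have dT : \det T = 1.
  rewrite det_trig; last first.
    apply/is_trig_mxP => i j ij; rewrite mxE.
    exact: (leq_sizeP _ _ (size_op_le mu i)).
  by rewrite big1// => i _; rewrite mxE op_lead.
have TH : T *m H *m T^T = diag_mx (\row_i nrm mu i).
  apply/matrixP => i j; rewrite !mxE.
  transitivity (mfun mu (op mu i * op mu j)).
    rewrite (mfunM (so i) (so j)); apply: eq_bigr => k _; rewrite !mxE.
    by congr (_ * _); apply: eq_bigr => l _; rewrite !mxE.
  have [->|ij] := eqVneq i j; first by rewrite mulr1n.
  rewrite mulr0n; case: (ltngtP i j) => [lt_ij|lt_ji|/val_inj ij'].
  - by rewrite mulrC op_orthogonal// (leq_trans (size_op_le _ _)).
  - by rewrite op_orthogonal// (leq_trans (size_op_le _ _)).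
  - by rewrite ij' eqxx in ij.
have := congr1 determinant TH; rewrite !det_mulmx det_tr dT mul1r mulr1 => ->.
by rewrite det_diag; apply: eq_bigr => i _; rewrite mxE.
Qed.

End PearsonIdentities.

(** * The moments of the weight *)

Section DirectionalDerivatives.
Context {R : realType} {V : normedModType R}.

(** Restriction to the line through [x] reduces directional derivatives to one variable, where the
    chain rule applies. *)
Lemma is_derive_lineP (f : V -> R) (x v : V) (df : R) :
  is_derive x v f df <-> is_derive (0 : R) (1 : R) (fun h => f (h *: v + x)) df.
Proof.
have e : (fun h : R => h^-1 *: (((fun h => f (h *: v + x)) \o shift 0) (h *: 1)
     - f (0 *: v + x))) = (fun h : R => h^-1 *: ((f \o shift x) (h *: v) - f x)).
  by apply/funext => h /=; rewrite scale0r add0r addr0 [h *: 1]mulr1.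
by split=> -[d1 d2]; split; move: d1 d2; rewrite /derivable /derive e.
Qed.

Lemma is_derive_comp (g : R -> R) (f : V -> R) (x v : V) (dg df : R) :
  is_derive (f x) (1 : R) g dg -> is_derive x v f df ->
  is_derive x v (g \o f) (dg * df).
Proof.
move=> hg /is_derive_lineP hf; apply/is_derive_lineP.
apply: (@is_derive1_comp _ g (fun h => f (h *: v + x))).
by rewrite scale0r add0r.
Qed.

Lemma is_derive_inv (f : V -> R) (x v : V) (df : R) : f x != 0 ->
  is_derive x v f df -> is_derive x v (fun y => (f y)^-1) (- (f x) ^- 2 * df).
Proof.
move=> f0 [d1 d2]; split; first exact: derivableV.
by rewrite deriveV// d2.
Qed.

Lemma is_derive_bigsum (I : Type) (r : seq I) (f : I -> V -> R) (df : I -> R)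
    (x v : V) :
  (forall i, is_derive x v (f i) (df i)) ->
  is_derive x v (fun y => \sum_(i <- r) f i y) (\sum_(i <- r) df i).
Proof.
move=> hf; elim: r => [|i r ih].
  rewrite big_nil (_ : (fun y => _) = cst 0); first exact: is_derive_cst.
  by apply/funext => y; rewrite big_nil.
rewrite big_cons (_ : (fun y => _) = f i + (fun y => \sum_(j <- r) f j y)).
  exact: is_deriveD.
by apply/funext => y; rewrite big_cons.
Qed.

End DirectionalDerivatives.

Lemma is_derive_coord (R : realType) (m : nat) (s v : 'rV[R]_m) (k : 'I_m) :
  is_derive s v (fun y => coord_t y k) (coord_t v k).
Proof.
apply/is_derive_lineP.
rewrite (_ : (fun h => _) = (coord_t v k \*: id) + cst (coord_t s k)).
  have := is_deriveD (is_deriveZ (coord_t v k) (is_derive_id (0 : R) (1 : R)))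
    (is_derive_cst (coord_t s k) (0 : R) (1 : R)).
  by move=> h; apply: (is_derive_eq h); rewrite addr0 [LHS]mulr1.
by apply/funext => h; rewrite /coord_t !mxE /= mulrC.
Qed.

Lemma coord_unitv (R : realType) (m : nat) (j k : 'I_m) :
  coord_t (unitv j : 'rV[R]_m) k = (j == k)%:R.
Proof. by rewrite /coord_t mxE eqxx eq_sym. Qed.

(** * Moments as sums of tail integrals, and their derivatives *)

Section Moments.
Context {R : realType} {m : nat} (omega0 : R) (omega : 'I_m -> R).
Notation mu := (@lebesgue_measure R).
Implicit Types s : 'rV[R]_m.

Let theta_tail (p : nat) (a : R) :
  (fun x => gmon p x * theta (x - a)) = gmon p \_ `]a, +oo[.
Proof.
apply/funext => x; rewrite patchE /theta subr_gt0 mem_setE in_itv/= andbT.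
by case: ifP => _; rewrite ?mulr1 ?mulr0.
Qed.

Let integrable_jump (p : nat) (a : R) :
  mu.-integrable setT (EFin \o (fun x => gmon p x * theta (x - a))).
Proof.
rewrite theta_tail -restrict_EFin.
have gi : mu.-integrable `]a, +oo[ (EFin \o gmon p).
  by apply: integrableS (integrable_gmon p).
by move/integrable_mkcond : gi; apply.
Qed.

Let weight_monE s (p : nat) : (fun x => x ^+ p * weight omega0 omega s x) =
  (fun x => omega0 * gmon p x +
    \sum_(k < m) omega k * (gmon p x * theta (x - coord_t s k))).
Proof.
apply/funext => x; rewrite /weight /gmon mulrA mulrDr [omega0 * _]mulrC.
congr (_ + _); rewrite big_distrr/=; apply: eq_bigr => k _.
by rewrite mulrCA.
Qed.

Let integrable_jumps s (r : seq 'I_m) (p : nat) : mu.-integrable setT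
  (EFin \o (fun x => \sum_(k <- r) omega k * (gmon p x * theta (x - coord_t s k)))).
Proof.
rewrite (_ : EFin \o _ = (fun x => \sum_(k <- r)
    ((omega k)%:E * (gmon p x * theta (x - coord_t s k))%:E))%E).
  apply: integrable_sum => // k _.
  exact: (integrableZl measurableT (omega k) (integrable_jump p (coord_t s k))).
by apply/funext => x /=; rewrite -sumEFin.
Qed.

Lemma integrable_weight_mon s (p : nat) :
  mu.-integrable setT (EFin \o (fun x => x ^+ p * weight omega0 omega s x)).
Proof.
rewrite weight_monE.
rewrite (_ : EFin \o _ = (fun x => omega0%:E * (gmon p x)%:E +
  (EFin \o (fun x => \sum_(k < m)
    omega k * (gmon p x * theta (x - coord_t s k)))%R) x)%E)//.
apply: integrableD => //.
by apply: integrableZl => //; exact: integrable_gmon.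
Qed.

Lemma momentE s (p : nat) : moment omega0 omega s p =
  omega0 * Rintegral mu setT (gmon p) +
  \sum_(k < m) omega k * Rintegral mu `]coord_t s k, +oo[ (gmon p).
Proof.
have gi := @integrable_gmon R p.
rewrite /moment weight_monE RintegralD//; last first.
  by apply: (integrableZl measurableT omega0 gi).
rewrite RintegralZl//; congr (_ + _).
elim: (index_enum _) => [|k r ih].
  rewrite big_nil; under eq_Rintegral do rewrite big_nil.
  by rewrite Rintegral_cst// mul0r.
rewrite big_cons; under eq_Rintegral do rewrite big_cons.
rewrite RintegralD//; last first.
  by apply: (integrableZl measurableT (omega k) (integrable_jump p (coord_t s k))).
by rewrite ih RintegralZl// theta_tail -Rintegral_mkcond.
Qed.

Lemma is_derive_moment s (p : nat) (k : 'I_m) :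
  is_derive s (unitv k) (fun y => moment omega0 omega y p)
    (- (omega k * gmon p (coord_t s k))).
Proof.
rewrite (_ : (fun y => _) = cst (omega0 * Rintegral mu setT (gmon p)) + (fun y =>
    \sum_(j < m) omega j * Rintegral mu `]coord_t y j, +oo[ (gmon p))); last first.
  by apply/funext => y; rewrite momentE.
rewrite -[X in is_derive _ _ _ X]add0r; apply: is_deriveD.
have := @is_derive_bigsum _ _ _ (index_enum 'I_m)
  (fun j y => omega j * Rintegral mu `]coord_t y j, +oo[ (gmon p))
  (fun j => omega j * (- gmon p (coord_t s j) * (k == j)%:R)) s (unitv k).
rewrite (bigD1 k)//= eqxx mulr1 mulrN big1 ?addr0; last first.
  by move=> j /negPf jk; rewrite eq_sym jk !mulr0.
apply=> j.
apply: (@is_deriveZ _ _ _ (fun y => Rintegral mu `]coord_t y j, +oo[ (gmon p))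
  (omega j)).
apply: (@is_derive_comp _ _ (fun a => Rintegral mu `]a, +oo[ (gmon p))
  (fun y => coord_t y j)); first exact: is_derive_gmon_tail.
by rewrite -(coord_unitv R); exact: is_derive_coord.
Qed.

(** Integration by parts on each tail yields the boundary term at its jump; the [omega0] part lives
    on the whole line and has no boundary term. *)
Lemma moment_pearson s (p : nat) :
  \sum_(k < m) - (omega k * gmon p (coord_t s k)) =
  pearson (moment omega0 omega s) p.
Proof.
have H := @Rintegral_gmon_rec R p; rewrite /pearson !momentE.
transitivity (omega0 * (p%:R * Rintegral mu setT (gmon p.-1) -
    2 * Rintegral mu setT (gmon p.+1)) +
  \sum_(k < m) omega k * (p%:R * Rintegral mu `]coord_t s k, +oo[ (gmon p.-1) -
    2 * Rintegral mu `]coord_t s k, +oo[ (gmon p.+1))).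
  rewrite H mulr0 add0r; apply: eq_bigr => k _.
  by rewrite Rintegral_gmon_tail_rec mulrN.
rewrite mulrBr; under eq_bigr do rewrite mulrBr mulrCA [omega _ * (2 * _)]mulrCA.
by rewrite sumrB -!mulr_sumr; ring.
Qed.

End Moments.

(** * Positive definiteness of the weight *)

Section Positivity.
Context {R : realType} {m : nat} (omega0 : R) (omega : 'I_m -> R).
Notation mu := (@lebesgue_measure R).
Implicit Types s t : 'rV[R]_m.

Definition ordered s := forall i j : 'I_m, (i < j)%N -> coord_t s i < coord_t s j.

(** The value of the step function once [l] jumps are passed. Ordinals start at 0, so [k < l]
    selects $\omega_1,\dots,\omega_l$. *)
Definition level (l : nat) : R := omega0 + \sum_(k < m | (k < l)%N) omega k.

Let weight_level s x l : (forall k, (coord_t s k < x) = (k < l)%N) ->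
  weight omega0 omega s x = expR (- x ^+ 2) * level l.
Proof.
move=> h; rewrite /weight /level; congr (_ * (_ + _)).
rewrite [RHS]big_mkcond; apply: eq_bigr => k _.
by rewrite /theta subr_gt0 h; case: ifP; rewrite ?mulr1 ?mulr0.
Qed.

Lemma weight_levelP s x : ordered s ->
  exists2 l, (l <= m)%N & weight omega0 omega s x = expR (- x ^+ 2) * level l.
Proof.
(* The number of jumps to the left of [x]; the empty maximum 0 covers the case of none. *)
move=> hs; exists (\max_(k < m | (coord_t s k < x)%R) k.+1)%N.
  by apply/bigmax_leqP => k _.
apply: weight_level => k; apply/idP/idP => [kx|].
  exact: (@leq_bigmax_cond _ (fun k => coord_t s k < x) (fun k : 'I_m => k.+1)).
apply: contraTT => kx; rewrite -leqNgt; apply/bigmax_leqP => j jx.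
rewrite ltnNge leq_eqVlt; apply/negP => /orP[/eqP/val_inj kj|kj].
  by rewrite kj jx in kx.
by move/negP : kx; apply; exact: lt_trans (hs _ _ kj) jx.
Qed.

Lemma level_interval s l : ordered s -> (l <= m)%N -> exists a b : R,
  a < b /\ forall x, a < x < b -> weight omega0 omega s x = expR (- x ^+ 2) * level l.
Proof.
move=> hs lm.
suff [a [b [ab h]]] : exists a b : R, a < b /\ forall k : 'I_m,
    if (k < l)%N then coord_t s k <= a else b <= coord_t s k.
  exists a, b; split=> // x /andP[ax xb]; apply: weight_level => k.
  have := h k; case: ifP => _ hk; first exact: le_lt_trans hk ax.
  by apply: negbTE; rewrite -leNgt; apply: ltW; exact: lt_le_trans xb hk.
have mono (i j : 'I_m) : (i <= j)%N -> coord_t s i <= coord_t s j.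
  by rewrite leq_eqVlt => /orP[/eqP/val_inj ->//|/hs/ltW].
have sb k : `|coord_t s k| <= \sum_j `|coord_t s j|.
  by rewrite (bigD1 k)//= lerDl sumr_ge0.
(* For level 0 the interval lies to the left of all jumps; otherwise it starts at the last jump
   passed and ends at the next one, or one unit further if there is none. *)
case: l lm => [|l] lm.
  exists (- \sum_j `|coord_t s j| - 1), (- \sum_j `|coord_t s j|).
  split=> [|k/=]; first by rewrite gtrDl ltrN10.
  by rewrite lerNl (le_trans _ (sb k))// lerNl lerNnormlW.
pose i := Ordinal lm; exists (coord_t s i).
have [lm1|lm1] := ltnP l.+1 m.
  exists (coord_t s (Ordinal lm1)); split; first exact: hs.
  by move=> k; case: ifPn => kl; apply: mono => //=; rewrite leqNgt.
exists (coord_t s i + 1); split; first by rewrite ltrDl.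
move=> k; rewrite ifT; first by apply: mono; rewrite -ltnS (leq_trans (ltn_ord k)).
by rewrite (leq_trans (ltn_ord k)).
Qed.

(** Integrability is carried along because the induction needs it to split the integral of a sum. *)
Lemma mfun_momentE s Q : mfun (moment omega0 omega s) Q =
  Rintegral mu setT (fun x => Q.[x] * weight omega0 omega s x) /\
  mu.-integrable setT (EFin \o (fun x => Q.[x] * weight omega0 omega s x)).
Proof.
rewrite /mfun (_ : (fun x => _) = (fun x =>
    \sum_(i < size Q) Q`_i * (x ^+ i * weight omega0 omega s x))); last first.
  apply/funext => x; rewrite horner_coef mulr_suml.
  by apply: eq_bigr => i _; rewrite -mulrA.
have wi := integrable_weight_mon omega0 omega s.
elim: (index_enum _) => [|k r [ih1 ih2]].
  rewrite (_ : (fun x => _) = cst 0); last by apply/funext => x; rewrite big_nil.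
  by rewrite big_nil Rintegral_cst// mul0r; split=> //; exact: integrable0.
rewrite (_ : (fun x => _) = (fun x => Q`_k * (x ^+ k * weight omega0 omega s x) +
    \sum_(i <- r) Q`_i * (x ^+ i * weight omega0 omega s x))); last first.
  by apply/funext => x; rewrite big_cons.
have wik : mu.-integrable setT
    (EFin \o (fun x => Q`_k * (x ^+ k * weight omega0 omega s x))).
  exact: (integrableZl measurableT Q`_k (wi k)).
split; last exact: (integrableD measurableT wik ih2).
by rewrite big_cons RintegralD// RintegralZl// ih1.
Qed.

Lemma mfun_moment_gt0 s l Q : (forall l : nat, (l <= m)%N -> 0 <= level l) ->
  ordered s -> (l <= m)%N -> 0 < level l -> Q != 0 ->
  0 < mfun (moment omega0 omega s) (Q * Q).
Proof.
move=> lev0 hs lm Wl Q0.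
have w0 x : 0 <= weight omega0 omega s x.
  by have [l' l'm ->] := weight_levelP x hs; rewrite mulr_ge0 ?expR_ge0 ?lev0.
have [a [b [ab hw]]] := level_interval hs lm.
have [x0 x0ab Qx0] : exists2 x0, a < x0 < b & Q.[x0] != 0.
  (* Distinct points of the interval; [size Q] of them cannot all be roots of [Q]. *)
  pose f (i : nat) := a + (b - a) / i.+2%:R.
  have d0 : 0 < b - a by rewrite subr_gt0.
  have fab i : a < f i < b.
    rewrite ltrDl divr_gt0//= -ltrBrDl ltr_pdivrMr// -[ltLHS]mulr1 ltr_pM2l//.
    by rewrite ltr1n.
  have [h|/allPn[_ /mapP[i _ ->]]] := boolP (all (root Q) (map f (iota 0 (size Q)))).
    have := max_poly_roots Q0 h; rewrite size_map size_iota ltnn => h'.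
    exfalso; apply: notF; apply: h'.
    rewrite map_inj_uniq ?iota_uniq// => i j.
    move=> /addrI /(mulfI (lt0r_neq0 d0)) /invr_inj /eqP.
    by rewrite eqr_nat => /eqP [].
  by move=> fi; exists (f i).
(* A continuous function that coincides with the integrand between [a] and [b]. *)
pose g x := (Q * Q).[x] * (expR (- x ^+ 2) * level l).
have g0 : 0 < g x0.
  by rewrite mulr_gt0 ?mulr_gt0 ?expR_gt0// hornerM -expr2 exprn_even_gt0.
have cg : continuous g.
  move=> x; apply: cvgM; first exact: continuous_horner.
  apply: cvgM; last exact: cvg_cst.
  apply: (cvg_comp (fun x => - x ^+ 2) expR); last exact: continuous_expR.
  by apply: cvgN; exact: exprn_continuous.
have [e e0 he] : exists2 e, 0 < e & forall x, x0 - e <= x <= x0 + e ->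
    a < x < b /\ g x0 / 2 <= g x.
  have : \forall x \near x0, a < x < b /\ g x0 / 2 <= g x.
    have [ax xb] := andP x0ab.
    near=> x; split; first (apply/andP; split).
    - by near: x; exact: lt_nbhsr.
    - by near: x; exact: lt_nbhsl.
    - by near: x; apply: (cvgr_ge (g x0)); [exact: cg | lra].
  move=> /nbhs_ballP[e/= e0 h]; exists (e / 2); first by rewrite divr_gt0.
  move=> x /andP[x1 x2]; apply: h.
  by rewrite /ball/= ltr_distlC; apply/andP; split; lra.
have [-> fi] := mfun_momentE s (Q * Q).
pose D := `[x0 - e, x0 + e]%classic.
have : Rintegral mu setT ((cst (g x0 / 2)) \_ D) <=
    Rintegral mu setT (fun x => (Q * Q).[x] * weight omega0 omega s x).
  apply: le_Rintegral => //.
    rewrite -restrict_EFin.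
    have : mu.-integrable D (EFin \o cst (g x0 / 2)).
      apply: continuous_compact_integrable; first exact: segment_compact.
      by apply: continuous_subspaceT => x; exact: cvg_cst.
    by move=> /integrable_mkcond; apply; exact: measurable_itv.
  move=> x _; case: ifPn => [/set_mem|_].
    rewrite /D/= in_itv/= => xD.
    by have [/hw -> ] := he x xD.
  by rewrite mulr_ge0// hornerM -expr2 sqr_ge0.
rewrite -Rintegral_mkcond Rintegral_cst; last exact: measurable_itv.
move=> h; apply: lt_le_trans h.
have muD : mu D = (e + e)%:E.
  rewrite lebesgue_measure_itv/= lte_fin ifT; last by lra.
  by rewrite -EFinB; congr _%:E; ring.
rewrite (_ : fine _ = fine (mu D))// muD mulr_gt0//=; first by rewrite divr_gt0.
exact: addr_gt0.
Unshelve. all: by end_near. Qed.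

End Positivity.

(** * Derivatives of orthogonal polynomials *)

Section PolynomialDerivatives.
Context {R : realType} {V : normedModType R} (t v : V).
Implicit Types (P Q : V -> {poly R}) (dP dQ : {poly R}).

(** Derivative coefficient by coefficient; the uniform degree bound turns functionals and
    evaluations into finite sums of fixed length. *)
Definition pderiv P dP := (exists N, forall s, (size (P s) <= N)%N) /\
  (forall i, is_derive t v (fun s => (P s)`_i) dP`_i).

Lemma size_pderiv P dP N : (forall s, (size (P s) <= N)%N) -> pderiv P dP ->
  (size dP <= N)%N.
Proof.
move=> PN [_ dPi]; apply/leq_sizeP => j Nj.
have : is_derive t v (fun s => (P s)`_j) 0.
  rewrite (_ : (fun s => _) = cst 0); first exact: is_derive_cst.
  by apply/funext => s; rewrite (leq_sizeP _ _ (PN s)).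
by case: (dPi j) => _ <- [_].
Qed.

Lemma pderiv_cst (p : {poly R}) : pderiv (fun=> p) 0.
Proof.
split; first by exists (size p).
by move=> i; rewrite coef0; exact: is_derive_cst.
Qed.

Lemma pderivB P Q dP dQ : pderiv P dP -> pderiv Q dQ ->
  pderiv (fun s => P s - Q s) (dP - dQ).
Proof.
move=> [[N hN] hP] [[M hM] hQ]; split.
  exists (maxn N M) => s; rewrite (leq_trans (size_polyD _ _))// size_polyN.
  by rewrite geq_max !leq_max hN hM orbT.
move=> i; rewrite coefB (_ : (fun s => _) = (fun s => (P s)`_i) - (fun s => (Q s)`_i)).
  exact: is_deriveB.
by apply/funext => s; rewrite coefB.
Qed.

Lemma pderivM P Q dP dQ : pderiv P dP -> pderiv Q dQ ->
  pderiv (fun s => P s * Q s) (dP * Q t + P t * dQ).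
Proof.
move=> [[N hN] hP] [[M hM] hQ]; split.
  exists (N + M)%N => s; rewrite (leq_trans (size_polyMleq _ _))//.
  by rewrite (leq_trans (leq_pred _)) ?leq_add.
move=> i; rewrite (_ : (fun s => _) =
    (fun s => \sum_(j < i.+1) (P s)`_j * (Q s)`_(i - j))).
  rewrite coefD !coefM -big_split/=; apply: is_derive_bigsum => j.
  apply: (is_derive_eq (is_deriveM (hP j) (hQ (i - j)%N))).
  by rewrite /GRing.scale/=; ring.
by apply/funext => s; rewrite coefM.
Qed.

Lemma pderivC (f : V -> R) df : is_derive t v f df -> pderiv (fun s => (f s)%:P) df%:P.
Proof.
move=> hf; split; first by exists 1%N => s; exact: size_polyC_leq1.
move=> i; rewrite coefC (_ : (fun s => _) = if i == 0%N then f else cst 0).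
  by case: ifP => _; [exact: hf|exact: is_derive_cst].
by apply/funext => s; rewrite coefC; case: ifP.
Qed.

Lemma is_derive_mfun (mu : V -> nat -> R) (dmu : nat -> R) P dP :
  (forall p, is_derive t v (fun s => mu s p) (dmu p)) -> pderiv P dP ->
  is_derive t v (fun s => mfun (mu s) (P s)) (mfun (mu t) dP + mfun dmu (P t)).
Proof.
move=> hmu hP; have [[N hN] hPi] := hP.
rewrite (mfunE _ (size_pderiv hN hP)) (mfunE _ (hN t)) -big_split/=.
rewrite (_ : (fun s => _) = (fun s => \sum_(i < N) (P s)`_i * mu s i)); last first.
  by apply/funext => s; rewrite (mfunE _ (hN s)).
apply: is_derive_bigsum => i; apply: (is_derive_eq (is_deriveM (hPi i) (hmu i))).
by rewrite /GRing.scale/=; ring.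
Qed.

Lemma is_derive_horner P dP (x : V -> R) dx : pderiv P dP -> is_derive t v x dx ->
  is_derive t v (fun s => (P s).[x s]) (dP.[x t] + (P t)^`().[x t] * dx).
Proof.
move=> hP hx; have [[N hN] hPi] := hP.
have -> : (P t)^`().[x t] = \sum_(i < N) (P t)`_i * (i%:R * x t ^+ i.-1).
  have {1}-> : P t = \sum_(i < N) (P t)`_i *: 'X^i.
    rewrite -poly_def; apply/polyP => i; rewrite coef_poly.
    by case: ltnP => // /(leq_sizeP _ _ (hN t)) ->.
  rewrite raddf_sum horner_sum; apply: eq_bigr => i _.
  by rewrite /= derivZ derivXn hornerZ hornerMn hornerXn mulr_natl.
rewrite (horner_coef_wide _ (size_pderiv hN hP)) mulr_suml -big_split/=.
rewrite (_ : (fun s => _) = (fun s => \sum_(i < N) (P s)`_i * x s ^+ i)); last first.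
  by apply/funext => s; rewrite (horner_coef_wide _ (hN s)).
apply: is_derive_bigsum => i.
have hX : is_derive t v (fun s => x s ^+ i) (i%:R * x t ^+ i.-1 * dx).
  rewrite (_ : (fun s => _) = x ^+ i); first exact: is_deriveX.
  by apply/funext => s; rewrite exprfctE.
apply: (is_derive_eq (is_deriveM (hPi i) hX)).
by rewrite /GRing.scale/=; ring.
Qed.

End PolynomialDerivatives.

(** * Variation of orthogonal polynomials, norms and Hankel determinants *)

Section OrthogonalPolynomialDerivatives.
Context {R : realType} {V : normedModType R} (t v : V).
Variables (mu : V -> nat -> R) (dmu : nat -> R).
Hypothesis dmuP : forall p, is_derive t v (fun s => mu s p) (dmu p).
Hypothesis mu_pos : \forall s \near t, posdef (mu s).

Let post : posdef (mu t). Proof. exact: nbhs_singleton mu_pos. Qed.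

(** Only existence is extracted from the recurrence, whose coefficients are quotients with nonzero
    denominators; the derivative is identified afterwards by orthogonality. *)
Let pderiv_op_ex n : exists dP, pderiv t v (fun s => op (mu s) n) dP.
Proof.
suff [] : (exists dP, pderiv t v (fun s => op (mu s) n) dP) /\
  (exists dP, pderiv t v (fun s => op_pred (mu s) n) dP) by [].
elim: n => [|n [[dP hP] [dQ hQ]]]; first by split; exists 0; exact: pderiv_cst.
split; last by exists dP.
have hPP := pderivM hP hP; have hXPP := pderivM (pderiv_cst t v 'X) hPP.
have dh := is_derive_mfun dmuP hPP.
have dhX := is_derive_mfun dmuP hXPP.
have n0 : nrm (mu t) n != 0 by exact: nrm_neq0.
have dalpha := is_deriveM dhX (is_derive_inv n0 dh).
have [dbeta hbeta] : exists df, is_derive t v (fun s => beta (mu s) n) df.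
  case: n hP hQ {dalpha dhX hXPP hPP n0} dh => [|n] hP hQ dh.
    by exists 0; exact: is_derive_cst.
  have n0 : nrm (mu t) n != 0 by exact: nrm_neq0.
  have dh' := is_derive_mfun dmuP (pderivM hQ hQ).
  by eexists; exact: (is_deriveM dh (is_derive_inv n0 dh')).
have hA := pderivB (pderiv_cst t v 'X) (pderivC dalpha).
have h := pderivB (pderivM hA hP) (pderivM (pderivC hbeta) hQ).
eexists.
rewrite (_ : (fun s => _) = (fun s => ('X - (alpha (mu s) n)%:P) * op (mu s) n -
    (beta (mu s) n)%:P * op_pred (mu s) n)); first exact: h.
by apply/funext => s; rewrite opS mul_polyC.
Qed.

(** The degree drops because the leading coefficient is constantly 1. The last clause differentiates
    $L(P_nQ)=0$, which holds for all parameters near [t]. *)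
Lemma pderiv_op n : exists dP, [/\ pderiv t v (fun s => op (mu s) n) dP,
  (size dP <= n)%N & forall Q : {poly R}, (size Q <= n)%N ->
    mfun (mu t) (dP * Q) = - mfun dmu (op (mu t) n * Q)].
Proof.
have [dP hP] := pderiv_op_ex n; exists dP; split => //.
  apply/leq_sizeP => j; rewrite leq_eqVlt => /predU1P[<-|nj].
    have [_ /(_ n) [_ <-]] := hP.
    rewrite (_ : (fun s => _) = cst 1) ?derive_cst//.
    by apply/funext => s; rewrite op_lead.
  by rewrite (leq_sizeP _ _ (size_pderiv (fun s => size_op_le (mu s) n) hP)).
move=> Q Qn; apply/eqP; rewrite -addr_eq0; apply/eqP.
have := is_derive_mfun dmuP (pderivM hP (pderiv_cst t v Q)).
rewrite mulr0 addr0 => -[_ <-].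
rewrite (@near_eq_derive _ _ _ _ (cst 0)) ?derive_cst//.
by near=> s; rewrite op_orthogonal//; near: s.
Unshelve. all: by end_near. Qed.

(** The derivative of $P_n$ has lower degree and is orthogonal to $P_n$, so only the functional
    contributes. *)
Lemma is_derive_nrm n : is_derive t v (fun s => nrm (mu s) n)
  (mfun dmu (op (mu t) n * op (mu t) n)).
Proof.
have [dP [hP sP _]] := pderiv_op n.
apply: (is_derive_eq (is_derive_mfun dmuP (pderivM hP hP))).
by rewrite [dP * _]mulrC mfunD !op_orthogonal// !add0r.
Qed.

Lemma is_derive_ln_hankel n : is_derive t v
  (fun s => ln (\det (\matrix_(i < n, j < n) mu s (i + j)%N)))
  (\sum_(j < n) mfun dmu (op (mu t) j * op (mu t) j) / nrm (mu t) j).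
Proof.
apply: (@near_eq_is_derive _ _ _ (fun s => \sum_(j < n) ln (nrm (mu s) j))).
  near=> s; have ps : posdef (mu s) by near: s.
  rewrite det_hankel//; elim: n => [|n ih]; first by rewrite !big_ord0 ln1.
  rewrite !big_ord_recr/= ih lnM ?posrE ?nrm_gt0//.
  by rewrite prodr_gt0// => i _; exact: nrm_gt0.
apply: is_derive_bigsum => j.
have h0 : 0 < nrm (mu t) j by exact: nrm_gt0.
apply: (is_derive_eq (is_derive_comp (is_derive1_ln h0) (is_derive_nrm j))).
exact: mulrC.
Unshelve. all: by end_near. Qed.

(** The quantity sought is the $x^n$ coefficient of the derivative of $P_{n+1}$, which pairing with
    $P_n$ isolates. *)
Lemma is_derive_subl n : is_derive t v (fun s => subl (mu s) n.+1)
  (- (mfun dmu (op (mu t) n.+1 * op (mu t) n) / nrm (mu t) n)).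
Proof.
have [dP [[_ hP] sP dPQ]] := pderiv_op n.+1.
apply: (is_derive_eq (hP n)); rewrite -mulNr -dPQ ?size_op_le//.
by rewrite [dP * _]mulrC mfun_op_proj// mulfK// nrm_neq0.
Qed.

End OrthogonalPolynomialDerivatives.

(** * The partial differential equation *)

(** Formulas for [sigma_n] hold at ordered points only; openness of that set allows them to be
    differentiated. *)
Lemma near_ordered (R : realType) (m : nat) (t : 'rV[R]_m) :
  ordered t -> \forall s \near t, ordered s.
Proof.
move=> ht; suff : \forall s \near t, forall ij : 'I_m * 'I_m,
    (ij.1 < ij.2)%N ==> (coord_t s ij.1 < coord_t s ij.2).
  by apply: filterS => s hs i j; exact/implyP/(hs (i, j)).
apply: (@filter_forall _ _ (fun (ij : 'I_m * 'I_m) (s : 'rV[R]_m) =>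
  (ij.1 < ij.2)%N ==> (coord_t s ij.1 < coord_t s ij.2) : Prop) (nbhs t) _).
move=> -[i j] /=.
have [ij|ij] := boolP (i < j)%N; last exact: nearW.
  have c : (fun s : 'rV[R]_m => coord_t s j - coord_t s i) @ t -->
      coord_t t j - coord_t t i.
    have cc k : (fun s : 'rV[R]_m => coord_t s k) @ t --> coord_t t k.
      exact: (@coord_continuous R 1 m ord0 k t).
    exact: (cvgB (cc j) (cc i)).
  near=> s; rewrite /= -subr_gt0; near: s.
  by apply: (cvgr_gt (coord_t t j - coord_t t i)); rewrite ?subr_gt0 ?ht.
Unshelve. all: by end_near. Qed.

(** * The function [sigma_n] and its derivatives through orthogonal polynomials *)

Section LogarithmicDerivatives.
Context {R : realType} {m : nat} (omega0 : R) (omega : 'I_m -> R) (l : nat).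
Hypothesis level_ge0 : forall l : nat, (l <= m)%N -> 0 <= level omega0 omega l.
Hypothesis lm : (l <= m)%N.
Hypothesis level_gt0 : 0 < level omega0 omega l.
Implicit Types (s t : 'rV[R]_m) (Q : {poly R}).

Let mu s := moment omega0 omega s.
Let wt s (k : 'I_m) := omega k * expR (- coord_t s k ^+ 2).
Let dmu s (k : 'I_m) (p : nat) := - (omega k * gmon p (coord_t s k)).

Let mu_pos s : ordered s -> posdef (mu s).
Proof. by move=> hs Q; exact: (mfun_moment_gt0 level_ge0 hs lm level_gt0). Qed.

Let mu_pos_near s : ordered s -> \forall u \near s, posdef (mu u).
Proof. by move=> /near_ordered; apply: filterS => u; exact: mu_pos. Qed.

Let dmuP s k p : is_derive s (unitv k) (fun u => mu u p) (dmu s k p).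
Proof. exact: is_derive_moment. Qed.

Let mfun_dmu s k Q : mfun (dmu s k) Q = - (wt s k * Q.[coord_t s k]).
Proof.
rewrite -mulNr -mfun_horner; apply: eq_mfun => p.
by rewrite /dmu /gmon /wt; ring.
Qed.

Let sum_dmu s Q : \sum_k mfun (dmu s k) Q = mfun (pearson (mu s)) Q.
Proof.
rewrite -mfun_summ; apply: eq_mfun => p; exact: moment_pearson.
Qed.

Let sum_wt s Q : \sum_k wt s k * Q.[coord_t s k] = - mfun (pearson (mu s)) Q.
Proof.
by rewrite -sum_dmu -sumrN; apply: eq_bigr => k _; rewrite mfun_dmu opprK.
Qed.

(** Summing over k inside $\sum_j\partial_k\ln h_j$ gives the Pearson functional of $P_j^2$ divided
    by $h_j$, that is $-2\alpha_j$. *)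
Lemma sigma_nE n s : ordered s -> sigma_n omega0 omega n s = 2 * subl (mu s) n.
Proof.
move=> hs; rewrite /sigma_n subl_sum.
under eq_bigr => k _.
  rewrite /partial (@derive_val _ _ _ _ _ _ _
    (is_derive_ln_hankel (dmuP s k) (mu_pos_near hs) n)).
  over.
rewrite exchange_big/= mulrN mulr_sumr -sumrN; apply: eq_bigr => j _.
rewrite -mulr_suml sum_dmu pearson_op_sqr; last exact: mu_pos.
by rewrite -mulNr mulrA mulfK ?nrm_neq0//; [rewrite mulNr|exact: mu_pos].
Qed.

(** Half of $\partial_k\sigma_{n+1}$. From here on the theorem's index is written [n.+1], so that
    its $P_{n-1}$ becomes [op (mu s) n]. *)
Let rho n s k := wt s k * ((op (mu s) n.+1).[coord_t s k] * (op (mu s) n).[coord_t s k])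
  / nrm (mu s) n.

Lemma partial_sigma n s k : ordered s ->
  partial k (sigma_n omega0 omega n.+1) s = 2 * rho n s k.
Proof.
move=> hs; rewrite /partial.
rewrite (@near_eq_derive _ _ _ _ (2 \*: (fun u => subl (mu u) n.+1))); last first.
  by near=> u; rewrite sigma_nE//; near: u; exact: near_ordered.
have h := is_deriveZ 2 (is_derive_subl (dmuP s k) (mu_pos_near hs) n).
rewrite (@derive_val _ _ _ _ _ _ _ h) mfun_dmu hornerM /rho.
by rewrite /GRing.scale/= mulNr opprK.
Unshelve. all: by end_near. Qed.

Let is_derive_wt s v k :
  is_derive s v (fun u => wt u k) (- (2 * coord_t s k * wt s k * coord_t v k)).
Proof.
have dc := is_derive_coord s v k.
have dX : is_derive s v (fun u => - coord_t u k ^+ 2)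
    (- (2 * coord_t s k * coord_t v k)).
  rewrite (_ : (fun u => _) = - ((fun u => coord_t u k) * (fun u => coord_t u k))).
    apply: (is_derive_eq (is_deriveN (is_deriveM dc dc))).
    by rewrite /GRing.scale/=; ring.
  by apply/funext => u; rewrite expr2.
have dE := is_derive_comp (is_derive_expR _) dX.
apply: (is_derive_eq (is_deriveZ (omega k) dE)).
by rewrite /wt /GRing.scale/=; ring.
Qed.

Lemma sum_partial_sigma n t k : ordered t ->
  \sum_j partial j (partial k (sigma_n omega0 omega n.+1)) t =
  4 * wt t k * (beta (mu t) n.+1 * (op (mu t) n).[coord_t t k] ^+ 2
    - (op (mu t) n.+1).[coord_t t k] ^+ 2) / nrm (mu t) n.
Proof.
move=> ht; have post := mu_pos ht; have nr := mu_pos_near ht.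
pose a u := op (mu u) n; pose b u := op (mu u) n.+1; pose x := coord_t t k.
have /choice[da hda] : forall j, exists dP, _ :=
  fun j => pderiv_op (dmuP t j) nr n.
have /choice[db hdb] : forall j, exists dP, _ :=
  fun j => pderiv_op (dmuP t j) nr n.+1.
pose h := nrm (mu t) n.
have h0 : h != 0 by exact: nrm_neq0.
pose dh j := mfun (dmu t j) (op (mu t) n * op (mu t) n).
pose c : R := 2 * wt t k.
(* Product rule: $t_j$ moves the polynomials and the norm for every j, but the evaluation point and
   the exponential only for j = k. *)
have rhoP j : partial j (partial k (sigma_n omega0 omega n.+1)) t =
    (c / h * (- (2 * x) * (b t).[x] * (a t).[x])) * (j == k)%:R
    + c / h * (a t).[x] * ((db j).[x] + (b t)^`().[x] * (j == k)%:R)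
    + c / h * (b t).[x] * ((da j).[x] + (a t)^`().[x] * (j == k)%:R)
    - c / h ^+ 2 * ((b t).[x] * (a t).[x]) * dh j.
  rewrite {1}/partial.
  rewrite (@near_eq_derive _ _ _ _ (2 \*: (fun u => rho n u k))); last first.
    by near=> u; rewrite partial_sigma//; near: u; exact: near_ordered.
  have dc := is_derive_coord t (unitv j) k; rewrite coord_unitv in dc.
  have [hb _ _] := hdb j; have [ha _ _] := hda j.
  have dab := is_deriveM (is_derive_horner hb dc) (is_derive_horner ha dc).
  have dw := is_derive_wt t (unitv j) k; rewrite coord_unitv in dw.
  have dn := is_derive_inv h0 (is_derive_nrm (dmuP t j) nr n).
  have D := is_deriveZ 2 (is_deriveM (is_deriveM dw dab) dn).
  rewrite (@derive_val _ _ _ _ _ _ _ D) /GRing.scale/= !fctE /= /c -/h -/(dh j).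
  have product_rule (w A B dA dB A' B' d e g y : R) : g != 0 ->
      2 * (w * (B * A) * (- g ^- 2 * e) + g^-1 * (w * (B * (dA + A' * d) +
        A * (dB + B' * d)) + B * A * - (2 * y * w * d))) =
      2 * w / g * (- (2 * y) * B * A) * d + 2 * w / g * A * (dB + B' * d) +
        2 * w / g * B * (dA + A' * d) - 2 * w / g ^+ 2 * (B * A) * e.
    by move=> g0; field.
  exact: product_rule.
(* Summed over j, the parameter derivatives join the single x-derivative into the combination that
   [pearson_toda] evaluates. *)
have Db : \sum_j db j + (b t)^`() = (2 * beta (mu t) n.+1) *: a t.
  apply: (pearson_toda post).
    by rewrite (leq_trans (size_sum _ _ _))//; apply/bigmax_leqP => j _; case: (hdb j).
  move=> Q Qn; rewrite mulr_suml mfun_sum -sum_dmu -sumrN.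
  by apply: eq_bigr => j _; case: (hdb j) => _ _ ->.
have Da : \sum_j da j + (a t)^`() = (2 * beta (mu t) n) *: op_pred (mu t) n.
  apply: (pearson_toda post).
    by rewrite (leq_trans (size_sum _ _ _))//; apply/bigmax_leqP => j _; case: (hda j).
  move=> Q Qn; rewrite mulr_suml mfun_sum -sum_dmu -sumrN.
  by apply: eq_bigr => j _; case: (hda j) => _ _ ->.
have sumk : \sum_(j < m) (j == k)%:R = 1 :> R.
  by rewrite (bigD1 k)//= eqxx big1 ?addr0// => j /negPf ->.
under eq_bigr do rewrite rhoP.
rewrite sumrB !big_split/= -!mulr_sumr !big_split/= -!mulr_sumr sumk !mulr1.
rewrite -!horner_sum -!hornerD Db Da /dh sum_dmu pearson_op_sqr// hornerZ.
(* The recurrence eliminates the third polynomial. The [x] term then cancels the derivative of the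
   exponential, and the [alpha] term that of the norm. *)
have -> : ((2 * beta (mu t) n) *: op_pred (mu t) n).[x] =
    2 * ((x - alpha (mu t) n) * (a t).[x] - (b t).[x]).
  rewrite hornerZ /b opS hornerD hornerN hornerZ hornerM hornerXsubC -/(a t).
  by ring.
by rewrite -/h -/(a t) -/(b t) -/x /c /beta -/h; field.
Unshelve. all: by end_near. Qed.

Lemma Lop_sigma n t : ordered t ->
  Lop (sigma_n omega0 omega n.+1) t = 4 * beta (mu t) n.+1 - 2 * n.+1%:R.
Proof.
move=> ht; have post := mu_pos ht; have h0 := nrm_neq0 post n.
rewrite /Lop; under eq_bigr do rewrite partial_sigma//.
rewrite -mulr_sumr -mulr_suml; under eq_bigr do rewrite -hornerM.
rewrite sum_wt pearson_op_succ// /beta; field.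
exact: h0.
Qed.

Lemma sg_sqrt_Delta n t k : ordered t ->
  Num.sg (omega k) * Num.sqrt (Delta_k (sigma_n omega0 omega n.+1) n.+1 k t) =
  4 / nrm (mu t) n *
   (beta (mu t) n.+1 * (wt t k * (op (mu t) n * op (mu t) n).[coord_t t k])
    + wt t k * (op (mu t) n.+1 * op (mu t) n.+1).[coord_t t k]).
Proof.
move=> ht; have post := mu_pos ht; have h0 := nrm_gt0 post n.
rewrite /Delta_k Lop_sigma// partial_sigma// /rho.
have -> : partial k (partial k (sigma_n omega0 omega n.+1)) t +
    \sum_(j < m | j != k) partial j (partial k (sigma_n omega0 omega n.+1)) t =
    \sum_j partial j (partial k (sigma_n omega0 omega n.+1)) t.
  by rewrite [RHS](bigD1 k).
rewrite sum_partial_sigma// !hornerM.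
set A := (op (mu t) n).[_]; set B := (op (mu t) n.+1).[_]; set h := nrm _ _.
set E := expR (- coord_t t k ^+ 2); set be := beta _ _.
have be0 : 0 <= be by rewrite divr_ge0// ltW// nrm_gt0.
(* By $(\beta A^2-B^2)^2+4\beta A^2B^2=(\beta A^2+B^2)^2$, [Delta_k] is the square of [omega k * X]
   with [X] nonnegative; the sign factor turns $|\omega_k|$ back into $\omega_k$. *)
pose X := 4 * (be * A ^+ 2 + B ^+ 2) * E / h.
have X0 : 0 <= X.
  apply: divr_ge0; last exact: ltW.
  apply: mulr_ge0; last exact: expR_ge0.
  by apply: mulr_ge0 => //; apply: addr_ge0; [apply: mulr_ge0 => //|]; exact: sqr_ge0.
have hn : h != 0 by rewrite gt_eqF.
rewrite [X in Num.sqrt X](_ : _ = (omega k * X) ^+ 2); last first.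
  by rewrite /X /wt -/E; field.
rewrite sqrtr_sqr normrM (ger0_norm X0) mulrA -numEsg /X /wt -/E.
by field.
Qed.

Lemma sigma_pde n t : ordered t ->
  \sum_(k < m) Num.sg (omega k) *
    Num.sqrt (Delta_k (sigma_n omega0 omega n.+1) n.+1 k t)
  = 2 * (\sum_(k < m) coord_t t k * partial k (sigma_n omega0 omega n.+1) t
         - sigma_n omega0 omega n.+1 t).
Proof.
move=> ht; have post := mu_pos ht; have h0 := nrm_neq0 post n.
under eq_bigr do rewrite sg_sqrt_Delta//.
rewrite -mulr_sumr big_split/= -mulr_sumr !sum_wt !pearson_op_sqr// sigma_nE//.
(* The factor $t_k$ is the value of ['X] at the jump, so this sum too is a Pearson functional; its
   [subl] term cancels $\sigma_n$. *)
have -> : \sum_(k < m) coord_t t k * partial k (sigma_n omega0 omega n.+1) t =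
    2 / nrm (mu t) n *
    \sum_k wt t k * ('X * (op (mu t) n.+1 * op (mu t) n)).[coord_t t k].
  rewrite mulr_sumr; apply: eq_bigr => k _.
  by rewrite partial_sigma// /rho !hornerM hornerX; ring.
rewrite sum_wt pearson_X_op_succ// /beta; field.
exact: h0.
Qed.

End LogarithmicDerivatives.

Theorem theorem4p2 (R : realType) (m : nat) (hm : (1 <= m)%N)
  (omega0 : R) (omega : 'I_m -> R)
  (hpos : forall l : nat, (l <= m)%N ->
            0 <= omega0 + \sum_(k < m | (k < l)%N) omega k)
  (n : nat) (hn : (1 <= n)%N)
  (t : 'rV[R]_m)
  (hord : forall i j : 'I_m, (i < j)%N -> coord_t t i < coord_t t j)
  (hnz : exists x : R, weight omega0 omega t x != 0) :
  \sum_(k < m) Num.sg (omega k) * Num.sqrt (Delta_k (sigma_n omega0 omega n) n k t)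
  = 2 * (\sum_(k < m) coord_t t k * partial k (sigma_n omega0 omega n) t
         - sigma_n omega0 omega n t).
Proof.
case: n hn => // n _; have [x wx] := hnz.
(* A point where the weight is nonzero supplies a level that is nonzero, hence positive. *)
have [l lm wl] := weight_levelP omega0 omega x hord.
apply: (@sigma_pde _ _ _ _ l) => //.
rewrite lt_def hpos// andbT; apply: contra wx => /eqP l0.
by rewrite wl l0 mulr0.
Qed.
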